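(* Let $(T_1,\dots,T_n)$ be a $Q$-commuting tuple of contractions acting on a Hilbert space $\mathcal{H}$. Then $\mathcal{H}$ admits an orthogonal decomposition $\mathcal{H}=\mathcal{H}(s)\oplus\left(\bigoplus_{1\le j\le n+1}\mathcal{H}_j\right)$ such that the following hold. (1) $\mathcal{H}_1,\dots,\mathcal{H}_{n+1},\mathcal{H}(s)$ are joint reducing subspaces for $T_1,\dots,T_n$ and $Q$. (2) $T_i|_{\mathcal{H}_j}$ is either a unitary or a c.n.u. contraction for $1\le i\le n$ and $1\le j\le n+1$. (3) If $\widetilde\Theta_n$ is the set of all functions $\widetilde\theta:\{1,\dots,n\}\to\{A_u,A_{cnu}\}$ such that at least $n-1$ of the values $\widetilde\theta(1),\dots,\widetilde\theta(n)$ are $A_u$, then for every $\widetilde\theta\in\widetilde\Theta_n$ there is a unique subspace $\mathcal{H}_t$ ($1\le t\le n+1$) such that the $k$-th component of $(T_1|_{\mathcal{H}_t},\dots,T_n|_{\mathcal{H}_t})$ is of the type $\widetilde\theta(k)$ for $1\le k\le n$ and $\mathcal{H}_t$ is the largest such joint reducing subspace for $T_1,\dots,T_n$ and $Q$. (4) $(T_1|_{\mathcal{H}(s)},\dots,T_n|_{\mathcal{H}(s)})$ is a strongly c.n.u. $Q$-commuting tuple of contractions. One or more subspaces in the decomposition may coincide with the subspace $\{0\}$.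
   Context: All operators are bounded linear maps on complex Hilbert spaces; a contraction is an operator of norm at most $1$. A tuple $(T_1,\dots,T_n)$ of operators on $\mathcal{H}$ is $Q$-commuting if there is a commuting family $Q=\{Q_{ij}\in\mathcal{B}(\mathcal{H}): Q_{ij}=Q_{ji}^*,\ i\ne j\}$ of unitaries such that $T_iT_j=Q_{ij}T_jT_i$ and $T_kQ_{ij}=Q_{ij}T_k$ for all $i\ne j$ and all $k$. A closed subspace is a joint reducing subspace for $T_1,\dots,T_n$ and $Q$ if it reduces every $T_i$ and every $Q_{ij}$. A contraction $T$ is completely non-unitary (c.n.u.) if there is no nonzero closed subspace that reduces $T$ and on which $T$ acts as a unitary. Type $A_u$ means unitary; type $A_{cnu}$ means c.n.u. contraction. An operator on the zero space is allowed to be of either type. A $Q$-commuting tuple $(T_1,\dots,T_n)$ of contractions is strongly c.n.u. if every joint reducing subspace $\mathcal{L}$ for $T_1,\dots,T_n$ and $Q$ such that at least $n-1$ of $T_1|_{\mathcal{L}},\dots,T_n|_{\mathcal{L}}$ are unitaries is $\mathcal{L}=\{0\}$. (For the tuple restricted to a joint reducing subspace, $Q$ is restricted to that subspace as well.) *)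

(* Defs.v *)
From HB Require Import structures.
From mathcomp Require Import all_boot all_order all_algebra.
From mathcomp Require Import complex.
From mathcomp Require Import all_classical all_reals all_analysis.

Set Implicit Arguments.
Unset Strict Implicit.
Unset Printing Implicit Defensive.

Import Order.TTheory GRing.Theory Num.Theory.
Import numFieldNormedType.Exports.

Local Open Scope classical_set_scope.
Local Open Scope ring_scope.

(* The form is linear in its first argument and conjugate-linear in the
   second. *)
HB.mixin Record CompleteNormedModule_isHilbert (R : realType) H
    of CompleteNormedModule R[i] H := {
  hdot : {dot H for (@Num.conj R[i])} ;
  hdot_norm : forall x : H, `|x| ^+ 2 = hdot x x
}.

#[short(type="hilbertType")]
HB.structure Definition Hilbert (R : realType) :=
  {H of CompleteNormedModule_isHilbert R H & CompleteNormedModule R[i] H}.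

Record bounded_op (R : realType) (H : hilbertType R) := BoundedOp {
  op_linear :> {linear H -> H} ;
  op_continuous : continuous (op_linear : H -> H)
}.

Section Operators.
Variables (R : realType) (H : hilbertType R).
Implicit Types (L M : set H) (T : bounded_op H).

Definition closed_subspace L :=
  [/\ L 0, forall (a : R[i]) (x y : H), L x -> L y -> L (a *: x + y)
    & closed L].

Definition orthogonal_sets L M :=
  forall x y, L x -> M y -> hdot x y = 0.

Definition orthocomplement L M : set H :=
  [set x | L x /\ forall y, M y -> hdot x y = 0].

(* The predicates below that take a closed subspace L as first argument speak
   about the operators T|_L on the Hilbert space L; an operator on the whole
   space is the case L = setT. Subspaces of L are given as subsets of H. *)

Definition invariant_on L (T : H -> H) := forall x, L x -> L (T x).

Definition adjoint_on L (T S : H -> H) :=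
  forall x y, L x -> L y -> hdot (T x) y = hdot x (S y).

Definition contraction_on L T :=
  invariant_on L T /\ forall x, L x -> `|T x| <= `|x|.

(* S is (T|_L)^*: only its values on L matter, and these are determined by
   T, so neither linearity nor continuity of S has to be required. *)
Definition unitary_on L T :=
  invariant_on L T /\
  exists S : H -> H, [/\ invariant_on L S, adjoint_on L T S,
    forall x, L x -> S (T x) = x & forall x, L x -> T (S x) = x].

Definition reduces_on L M T :=
  [/\ closed_subspace M, M `<=` L, invariant_on M T
    & invariant_on (orthocomplement L M) T].

Definition cnu_on L T :=
  contraction_on L T /\
  forall M, reduces_on L M T -> unitary_on M T -> M = [set 0].

Section Tuples.
Variables (n : nat) (T : 'I_n -> bounded_op H)
  (Q : 'I_n -> 'I_n -> bounded_op H).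

(* The diagonal entries Q i i are never used. *)
Definition q_commuting_on L :=
  [/\ forall k, invariant_on L (T k),
      forall i j, i != j ->
        unitary_on L (Q i j) /\ adjoint_on L (Q j i) (Q i j),
      forall i j k l, i != j -> k != l ->
        forall x, L x -> Q i j (Q k l x) = Q k l (Q i j x),
      forall i j, i != j ->
        forall x, L x -> T i (T j x) = Q i j (T j (T i x))
    & forall i j k, i != j ->
        forall x, L x -> T k (Q i j x) = Q i j (T k x)].

Definition joint_reducing_on L M :=
  [/\ closed_subspace M, M `<=` L, forall i, reduces_on L M (T i)
    & forall i j, i != j -> reduces_on L M (Q i j)].

Definition all_but_at_most_one (P : 'I_n -> Prop) :=
  (n.-1 <= #|[set i : 'I_n | `[< P i >]]%SET|)%N.

Definition strongly_cnu_on L :=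
  forall M, joint_reducing_on L M ->
    all_but_at_most_one (fun i => unitary_on M (T i)) -> M = [set 0].

End Tuples.

Definition orthogonal_decomposition (m : nat) (Hs : set H)
    (Hj : 'I_m -> set H) :=
  [/\ closed_subspace Hs /\ forall j, closed_subspace (Hj j),
      forall j, orthogonal_sets Hs (Hj j),
      forall j k, j != k -> orthogonal_sets (Hj j) (Hj k)
    & forall x : H, exists (xs : H) (xj : 'I_m -> H),
        [/\ Hs xs, forall j, Hj j (xj j) & x = xs + \sum_(j < m) xj j]].

Inductive op_type := A_u | A_cnu.

Definition has_type_on L T (t : op_type) :=
  match t with
  | A_u => unitary_on L T
  | A_cnu => cnu_on L T
  end.

Definition joint_reducing_of_type (n : nat) (T : 'I_n -> bounded_op H)
    (Q : 'I_n -> 'I_n -> bounded_op H) (theta : 'I_n -> op_type) L :=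
  joint_reducing_on T Q setT L /\ forall k, has_type_on L (T k) (theta k).

Definition largest (P : set H -> Prop) L := P L /\ forall M, P M -> M `<=` L.

End Operators.

(* Main.v *)
(* The letters T_i, T_i^*, Q_ij form a family closed under adjoints, so a closed
   subspace jointly reduces T and Q iff it is stable under every letter. For a
   set A of indices let U_A be the annihilator of all words in the letters
   applied to the ranges of T_k^* T_k - 1 and T_k T_k^* - 1, k in A. It is the
   largest joint reducing subspace on which the T_k, k in A, are unitary, and
   projecting onto a joint reducing subspace maps it into itself.
   The summands are U_{all}, the complements of U_{all} in U_{k <> i}, and what
   is orthogonal to all of these. The key point is that T_i is c.n.u. on
   U_{k <> i} - U_{all}: the unitary T_j, T_j^* (j <> i) intertwine T_i and
   T_i^* up to unitaries Q, so the orbit under the letters other than T_i, T_i^*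
   of a T_i-reducing subspace where T_i is unitary is stable, T_i is unitary on
   it, and hence it lies in U_{all}. *)
Require Import Defs.
From mathcomp Require Import all_boot all_order all_algebra.
From mathcomp Require Import complex.
From mathcomp Require Import all_classical all_reals all_analysis.
From mathcomp Require Import ring lra.

Set Implicit Arguments.
Unset Strict Implicit.
Unset Printing Implicit Defensive.

Import Order.TTheory GRing.Theory Num.Theory.
Import numFieldNormedType.Exports.

Local Open Scope classical_set_scope.
Local Open Scope ring_scope.
Local Open Scope complex_scope.

(** * Inner product and norm *)

Section HilbertSpace.
Variables (R : realType) (H : hilbertType R).
Implicit Types (x y z u v : H) (F : set H).

Lemma hdotDl x y z : hdot (x + y) z = hdot x z + hdot y z.
Proof. exact: linearDl. Qed.
Lemma hdotDr x y z : hdot z (x + y) = hdot z x + hdot z y.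
Proof. exact: linearDr. Qed.
Lemma hdotNl x z : hdot (- x) z = - hdot x z.
Proof. exact: linearNl. Qed.
Lemma hdotBl x y z : hdot (x - y) z = hdot x z - hdot y z.
Proof. exact: linearBl. Qed.
Lemma hdotBr x y z : hdot z (x - y) = hdot z x - hdot z y.
Proof. exact: linearBr. Qed.
Lemma hdotZl (a : R[i]) x z : hdot (a *: x) z = a * hdot x z.
Proof. exact: linearZl_LR. Qed.
Lemma hdotZr (a : R[i]) x z : hdot z (a *: x) = Num.conj a * hdot z x.
Proof. exact: linearZr_LR. Qed.
Lemma hdot0l x : hdot 0 x = 0.
Proof. exact: linear0l. Qed.
Lemma hdot0r x : hdot x 0 = 0.
Proof. exact: linear0r. Qed.
Lemma hdotC x y : hdot x y = Num.conj (hdot y x).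
Proof. by rewrite (hermC hdot) expr0 mul1r. Qed.

Lemma hdot_eq0C x y : hdot x y = 0 -> hdot y x = 0.
Proof. by move=> xy; rewrite hdotC xy rmorph0. Qed.

Lemma hdot_self_eq0 x : hdot x x = 0 -> x = 0.
Proof. by move/eqP; rewrite (dnorm_eq0 hdot) => /eqP. Qed.

(** The norm of [H] takes its values in [R[i]]; infima and real arithmetic need it in [R]. *)
Definition rnorm x : R := complex.Re `|x|.

Lemma rnormE x : `|x| = (rnorm x)%:C.
Proof. by rewrite RRe_real// normr_real. Qed.

Lemma rnorm_ge0 x : 0 <= rnorm x.
Proof. by rewrite -ler0c -rnormE. Qed.

Lemma rnorm_sqr x : hdot x x = (rnorm x ^+ 2)%:C.
Proof. by rewrite -hdot_norm rnormE rmorphXn. Qed.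

Lemma ler_rnormD x y : rnorm (x + y) <= rnorm x + rnorm y.
Proof. by rewrite -lecR rmorphD /= -!rnormE ler_normD. Qed.

Lemma rnormN x : rnorm (- x) = rnorm x.
Proof. by rewrite /rnorm normrN. Qed.

Lemma parallelogram u v :
  rnorm (u - v) ^+ 2 + rnorm (u + v) ^+ 2 =
  (rnorm u ^+ 2 + rnorm v ^+ 2) *+ 2.
Proof.
apply: complexI; rewrite rmorphMn !rmorphD /= -!rnorm_sqr.
rewrite hdotBl !hdotBr hdotDl !hdotDr; ring.
Qed.

Lemma rnormZ_nat (k : nat) x : rnorm (k%:R *: x) = k%:R * rnorm x.
Proof.
apply: complexI.
by rewrite rmorphM rmorph_nat /= -!rnormE normrZ normr_nat.
Qed.

(* Expand the squared norm of [u - a z], [a = <u,z> / <z,z>]. *)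
Lemma hdot_eq0_min u z :
  (forall a : R[i], rnorm u <= rnorm (u - a *: z)) -> hdot u z = 0.
Proof.
move=> umin; have [->|z0] := eqVneq z 0; first exact: hdot0r.
have zz : 0 < hdot z z by rewrite (dnorm_gt0 hdot).
set c := hdot u z; pose a := c / hdot z z.
have : hdot u u <= hdot (u - a *: z) (u - a *: z).
  by rewrite !rnorm_sqr lecR ler_sqr ?nnegrE ?rnorm_ge0.
have -> : hdot (u - a *: z) (u - a *: z) = hdot u u - `|c| ^+ 2 / hdot z z.
  rewrite hdotBl !hdotBr !hdotZl !hdotZr -/c (hdotC z u) -/c normCK.
  have -> : Num.conj a = Num.conj c / hdot z z.
    by rewrite /a rmorphM fmorphV /= -(hdotC z z).
  by rewrite /a; field; rewrite gt_eqF.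
rewrite lerDl oppr_ge0 => le0; apply/eqP; rewrite -normr_eq0 -sqrf_eq0.
rewrite -(mulrVK (unitf_gt0 zz) (`|c| ^+ 2)) mulf_eq0; apply/orP; left.
by rewrite eq_le le0 divr_ge0// ?exprn_ge0// ltW.
Qed.

(** * Orthogonal projection onto a closed subspace *)

Section Projection.
Variables (F : set H) (x : H).
Hypothesis (clF : closed_subspace F).

Let F0 : F 0. Proof. by case: clF. Qed.
Let FD y z : F y -> F z -> F (y + z).
Proof. by case: clF => _ + _ Fy Fz => /(_ 1 y z Fy Fz); rewrite scale1r. Qed.
Let FZ (a : R[i]) y : F y -> F (a *: y).
Proof. by case: clF => _ + _ Fy => /(_ a y 0 Fy F0); rewrite addr0. Qed.

Let D := inf [set rnorm (x - y) | y in F].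

Let has_lb : has_lbound [set rnorm (x - y) | y in F].
Proof. by exists 0 => _ [y _ <-]; exact: rnorm_ge0. Qed.

Let D_le y : F y -> D <= rnorm (x - y).
Proof. by move=> Fy; apply: ge_inf => //; exists y. Qed.

Let D_ge0 : 0 <= D.
Proof.
apply: lb_le_inf; first by exists (rnorm (x - 0)), 0.
by move=> _ [y _ <-]; exact: rnorm_ge0.
Qed.

(** These sets are the base of a filter whose limit is the projection of [x] onto [F]; [D] is the
    distance from [x] to [F]. *)
Let near_min t := [set y | F y /\ rnorm (x - y) < D + t].

Let near_min_ex t : 0 < t -> near_min t !=set0.
Proof.
move=> t0.
have [|_ [y Fy <-] yt] := @inf_adherent R [set rnorm (x - y) | y in F] t t0.
  by split=> //; exists (rnorm (x - 0)), 0.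
by exists y.
Qed.

(** The midpoint of [y] and [z] lies in [F], so its distance to [x] is at least [D]; the
    parallelogram law then bounds [y - z]. *)
Let near_min_close e : 0 < e ->
  exists2 t, 0 < t &
    forall y z, near_min t y -> near_min t z -> rnorm (y - z) < e.
Proof.
(* The parallelogram law gives a squared distance below 4(D + t)^2 - 4D^2 = 8Dt + 4t^2, which is at
   most (8D + 4)t once t <= 1. *)
move=> e0; pose t := Num.min 1 (e ^+ 2 / (8 * D + 4)).
have den : 0 < 8 * D + 4 by have := D_ge0; lra.
have t0 : 0 < t by rewrite lt_min ltr01 divr_gt0// exprn_gt0.
have t1 : t <= 1 by rewrite ge_min lexx.
have te : (8 * D + 4) * t <= e ^+ 2.
  by rewrite mulrC -ler_pdivlMr// ge_min lexx orbT.
exists t => // y z [Fy ymin] [Fz zmin].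
have mid : 2 * D <= rnorm ((x - y) + (x - z)).
  have -> : (x - y) + (x - z) = 2%:R *: (x - 2^-1 *: (y + z)).
    rewrite scalerBr scalerA mulfV ?pnatr_eq0// scale1r scaler_nat mulr2n.
    by rewrite opprD addrACA.
  by rewrite rnormZ_nat ler_pM2l// D_le//; apply/FZ/FD.
have xyz : (x - y) - (x - z) = z - y by rewrite opprB addrC subrKA.
have := parallelogram (x - y) (x - z).
rewrite xyz -opprB rnormN => par.
have sqlt w : rnorm w < D + t -> rnorm w ^+ 2 < (D + t) ^+ 2.
  move=> wt; rewrite ltr_sqr ?nnegrE ?rnorm_ge0//.
  by rewrite addr_ge0// ltW.
have /sqlt := ymin; have /sqlt := zmin => zsq ysq.
have midsq : (2 * D) ^+ 2 <= rnorm ((x - y) + (x - z)) ^+ 2.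
  by rewrite ler_sqr ?nnegrE ?rnorm_ge0// mulr_ge0.
have tt : t ^+ 2 <= t by rewrite expr2 ger_pMl.
rewrite -ltr_sqr ?nnegrE ?rnorm_ge0 ?(ltW e0)//.
nra.
Qed.

(** The limit of the Cauchy filter of near-minimizers is a nearest point of [F], and [hdot_eq0_min]
    turns minimality into orthogonality. *)
Lemma projection_exists :
  exists y, F y /\ forall z, F z -> hdot (x - y) z = 0.
Proof.
pose G := filter_from [set t : R | 0 < t] near_min.
have GF : ProperFilter G.
  apply: filter_from_proper; last by move=> t /near_min_ex.
  apply: filter_from_filter; first by exists 1; rewrite /= ltr01.
  move=> s t s0 t0; exists (Num.min s t); first by rewrite /= lt_min s0.
  move=> y [Fy yst]; split; split=> //; apply: (lt_le_trans yst).
    by rewrite lerD2l ge_min lexx.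
  by rewrite lerD2l ge_min lexx orbT.
have G_near t : 0 < t -> G (near_min t) by move=> t0; exists t.
have Gcauchy : cauchy G.
  apply: cauchy_exP => eps eps0.
  (* A radius is an element of [R[i]]; being positive there forces it to be real. *)
  have [epsE e0] : eps = (complex.Re eps)%:C /\ 0 < complex.Re eps.
    have epsE : eps = (complex.Re eps)%:C by rewrite RRe_real// gtr0_real.
    by split=> //; rewrite -ltcR -epsE.
  have [t t0 tclose] := near_min_close e0.
  have [y yt] := near_min_ex t0; exists y; exists t => // z zt.
  by rewrite -ball_normE /= rnormE epsE ltcR; exact: tclose.
have /cauchy_cvgP Gcvg := Gcauchy.
have {Gcvg} [y Gy] : exists y, G --> y by exists (lim G).
have Fy : F y.
  have clF3 : closed F by case: clF.
  apply: (@closed_cvg _ _ G _ id F clF3 _ y) => //.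
  by exists 1 => [|z []]; rewrite /= ?ltr01.
exists y; split=> // z Fz; apply: hdot_eq0_min => a.
have -> : x - y - a *: z = x - (y + a *: z) by rewrite opprD addrA.
apply: le_trans (D_le (FD Fy (FZ a Fz))).
(* It remains to show that [y] attains [D]: up to [e], compare it with a near-minimizer [w] close to
   it. *)
apply/ler_addgt0Pr => e e0.
have e20 : 0 < e / 2 by rewrite divr_gt0.
have [w [[Fw wmin] yw]] : (near_min (e / 2) `&` ball y (e / 2)%:C) !=set0.
  apply: (@filter_ex _ G); apply: filterI; first exact: G_near.
  by apply: Gy; apply: nbhsx_ballx; rewrite ltcR.
have {}yw : rnorm (y - w) < e / 2.
  by move: yw; rewrite -ball_normE /= rnormE ltcR.
have := ler_rnormD (x - w) (- (y - w)).
rewrite rnormN opprB addrA subrK; lra.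
Qed.
End Projection.

(** * Annihilators and orthogonal complements *)

Definition annihilator (V : set H) : set H :=
  [set x | forall v, V v -> hdot x v = 0].

(** For closedness, take [w] in the annihilator near [x]. By Pythagoras [w] is no longer than
    [w - a *: v], so the same holds for [x] up to [e], and [hdot_eq0_min] applies. *)
Lemma closed_subspace_annihilator (V : set H) : closed_subspace (annihilator V).
Proof.
split=> [v _|a x y Vx Vy v Vv|x clx v Vv]; first exact: hdot0l.
  by rewrite hdotDl hdotZl Vx// Vy// mulr0 addr0.
apply: hdot_eq0_min => a; apply/ler_addgt0Pr => e e0.
have e20 : 0 < e / 2 by rewrite divr_gt0.
have [w [Vw xw]] : annihilator V `&` ball x (e / 2)%:C !=set0.
  by apply: clx; apply: nbhsx_ballx; rewrite ltcR.
have {}xw : rnorm (x - w) < e / 2.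
  by move: xw; rewrite -ball_normE /= rnormE ltcR.
have wmin : rnorm w <= rnorm (w - a *: v).
  rewrite -ler_sqr ?nnegrE ?rnorm_ge0// -lecR -!rnorm_sqr.
  have wv : hdot w (a *: v) = 0 by rewrite hdotZr Vw// mulr0.
  rewrite hdotBl !hdotBr wv (hdot_eq0C wv) subr0 sub0r opprK lerDl.
  exact: (dnorm_ge0 hdot).
have x1 := ler_rnormD (x - w) w; rewrite subrK in x1.
have := ler_rnormD (x - a *: v) (- (x - w)).
rewrite rnormN opprB addrC addrA subrK; lra.
Qed.

Lemma hdot_inj x y : (forall z, hdot z x = hdot z y) -> x = y.
Proof.
move=> xy; apply/eqP; rewrite -subr_eq0; apply/eqP/hdot_self_eq0.
by rewrite hdotBr xy subrr.
Qed.

Lemma closed_subspaceB F x y : closed_subspace F -> F x -> F y -> F (x - y).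
Proof.
case=> _ + _ Fx Fy => /(_ (-1) y x Fy Fx).
by rewrite scaleN1r addrC.
Qed.

Lemma closed_subspace_orthocomplement (L M : set H) :
  closed_subspace L -> closed_subspace (orthocomplement L M).
Proof.
case=> L0 LD clL; have [M0 MD clM] := closed_subspace_annihilator M.
split; first by split.
  by move=> a x y [Lx Mx] [Ly My]; split; [exact: LD | exact: MD].
have -> : orthocomplement L M = L `&` annihilator M by [].
exact: closedI.
Qed.

Lemma closed_subspace_eq0 F : closed_subspace F ->
  (forall x, F x -> x = 0) -> F = [set 0].
Proof.
by case=> M0 _ _ Mz; apply/seteqP; split=> x /= => [/Mz|->].
Qed.

(** * Riesz representation, adjoints and unitarity *)

Lemma riesz (T : bounded_op H) y : exists s, forall x, hdot (T x) y = hdot x s.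
Proof.
have [all0|/existsNP[x0 /eqP Tx0]] := pselect (forall x, hdot (T x) y = 0).
  by exists 0 => x; rewrite hdot0r.
pose K := [set x | hdot (T x) y = 0].
have clK : closed_subspace K.
  split; first by rewrite /K/= linear0 hdot0l.
    by move=> a u v Ku Kv; rewrite /K/= linearP hdotDl hdotZl Ku Kv mulr0 addr0.
  have -> : K = T @^-1` annihilator [set y].
    by apply/seteqP; split=> x /= Kx; [move=> _ -> | exact: Kx].
  have /continuous_closedP := @op_continuous _ _ T; apply.
  by case: (closed_subspace_annihilator [set y]).
(* The component [z] of [x0] orthogonal to the kernel [K] represents the functional up to a scalar,
   and testing on [z] itself fixes that scalar. *)
have [p [Kp zK]] := projection_exists x0 clK.
set z := x0 - p in zK; pose c := hdot (T z) y.
have c0 : c != 0 by rewrite /c linearB hdotBl [X in _ - X]Kp subr0.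
have zz0 : hdot z z != 0.
  rewrite (dnorm_eq0 hdot); apply: contra c0 => /eqP z0.
  by rewrite /c z0 linear0 hdot0l.
exists ((Num.conj c / hdot z z) *: z) => x.
have /zK/hdot_eq0C : K (x - (hdot (T x) y / c) *: z).
  rewrite /K/= linearB linearZ /= hdotBl hdotZl -/c.
  by rewrite divfK// subrr.
rewrite hdotBl hdotZl => /subr0_eq xz.
rewrite hdotZr rmorphM fmorphV /= conjCK -(hdotC z z) xz.
by field; rewrite c0.
Qed.

(** A plain function built from chosen Riesz vectors; since the form is nondegenerate, [adjE]
    determines it. *)
Definition adj (T : bounded_op H) y : H := sval (cid (riesz T y)).

Lemma adjE (T : bounded_op H) x y : hdot (T x) y = hdot x (adj T y).
Proof. exact: (svalP (cid (riesz T y))). Qed.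

Lemma adjEC (T : bounded_op H) x y : hdot (adj T x) y = hdot x (T y).
Proof. by rewrite hdotC -adjE -hdotC. Qed.

Lemma reduces_on_adjoint (L M : set H) (f : bounded_op H) (g : H -> H) :
  (forall x y, hdot (f x) y = hdot x (g y)) ->
  closed_subspace M -> M `<=` L -> invariant_on L f ->
  invariant_on M f -> invariant_on M g -> reduces_on L M f.
Proof.
move=> fg clM ML Lf Mf Mg; split=> // x [Lx xM]; split; first exact: Lf.
by move=> y My; rewrite fg xM//; exact: Mg.
Qed.

(** Let [r] be the component of [adj T y] orthogonal to [M]. Then <r, r> = <r, T^* y> = <T r, y> =
    0, because [T] preserves the complement of [M] in [L]. *)
Lemma reduces_on_adj (L M : set H) (T : bounded_op H) :
  closed_subspace L -> invariant_on L (adj T) -> reduces_on L M T ->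
  invariant_on M (adj T).
Proof.
move=> clL Ladj [clM ML MT MpT] y My.
have [p [Mp rM]] := projection_exists (adj T y) clM.
suff -> : adj T y = p by [].
apply/eqP; rewrite -subr_eq0; apply/eqP/hdot_self_eq0.
set r := adj T y - p in rM *.
have [_ TrM] : orthocomplement L M (T r).
  apply: MpT; split=> //; apply: closed_subspaceB => //; last exact: ML.
  exact/Ladj/ML.
by rewrite {2}/r hdotBr (rM p Mp) subr0 -adjE TrM.
Qed.

(** Unitarity at a single vector can be tested on sets that are not subspaces, such as orbits. *)
Definition unitary_at (T : bounded_op H) x :=
  adj T (T x) = x /\ T (adj T x) = x.

(** On [M] the map [S] of [unitary_on] agrees with [adj T]: their difference at a point of [M] stays
    in [M] and is orthogonal to itself. *)
Lemma unitary_onP (M : set H) (T : bounded_op H) :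
  closed_subspace M -> invariant_on M T -> invariant_on M (adj T) ->
  unitary_on M T <-> forall x, M x -> unitary_at T x.
Proof.
move=> clM MT Madj; split=> [[_ [S [MS TS ST TS1]]] x Mx|uT]; last first.
  split=> //; exists (adj T); split=> //; first by move=> x y _ _; exact: adjE.
    by move=> x /uT[].
  by move=> x /uT[].
have SE y : M y -> adj T y = S y.
  move=> My; apply/eqP; rewrite -subr_eq0; apply/eqP/hdot_self_eq0.
  rewrite hdotBr -adjE TS ?subrr//.
  by apply: closed_subspaceB => //; [exact: Madj | exact: MS].
by split; rewrite SE//; [exact: ST | exact: MT | exact: TS1].
Qed.

End HilbertSpace.

(** * Finite orthogonal families and a counting lemma *)

Lemma orthogonal_decomposition_annihilator (R : realType) (H : hilbertType R)
    (m : nat) (Hj : 'I_m -> set H) :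
  (forall j, closed_subspace (Hj j)) ->
  (forall j k, j != k -> orthogonal_sets (Hj j) (Hj k)) ->
  orthogonal_decomposition (annihilator (\bigcup_j Hj j)) Hj.
Proof.
move=> clHj ortho; split=> //.
- by split=> [|j]; [exact: closed_subspace_annihilator | exact: clHj].
- by move=> j x y xA Hy; apply: xA; exists j.
- move=> x; have /choice[p pP] := fun j => projection_exists x (clHj j).
  exists (x - \sum_(j < m) p j), p; split; last by rewrite subrK.
    move=> y [j _ Hy]; have [Hp xp] := pP j.
    rewrite (bigD1 j)//= opprD addrA hdotBl xp// sub0r.
    apply/eqP; rewrite oppr_eq0; apply/eqP.
    elim/big_ind: _ => [|u v uy vy|k kj]; first exact: hdot0l.
      by rewrite hdotDl uy vy addr0.
    by have [Hpk _] := pP k; exact: (ortho k j kj).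
  by move=> j; have [] := pP j.
Qed.

(** Two distinct indices outside [P], added to the at least [n.-1] indices inside, would be more
    than [n]. *)
Lemma all_but_at_most_oneP (n : nat) (P : 'I_n -> Prop) :
  all_but_at_most_one P ->
  (forall k, P k) \/ exists i, ~ P i /\ forall k, k != i -> P k.
Proof.
rewrite /all_but_at_most_one => nP.
have [allP|/existsNP[i Pi]] := pselect (forall k, P k); [by left|right].
exists i; split=> // k ki; apply: contrapT => Pk.
have : (#|[set k | `[< P k >]]%SET :|: [set i; k]| <= n)%N.
  by rewrite -[leqRHS]card_ord max_card.
rewrite cardsU cards2 (eq_sym i k) ki.
have -> : [set k0 | `[< P k0 >]]%SET :&: [set i; k] = finset.set0.
  apply/finset.setP => j; rewrite !inE; apply/negP => /andP[/asboolP Pj].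
  by case/orP => /eqP jE; subst j.
rewrite cards0 subn0 addn2 => lt_n.
suff : (n < n)%N by rewrite ltnn.
(* [leqSpred] also covers n = 0, where the predecessor is truncated. *)
apply: leq_ltn_trans (leqSpred n) _.
exact: leq_ltn_trans (nP : n.-1.+1 <= _.+1)%N lt_n.
Qed.

(** * Commutation relations, letters and joint reducing subspaces *)

Section QCommutingTuple.
Variables (R : realType) (H : hilbertType R) (n : nat).
Variables (T : 'I_n -> bounded_op H) (Q : 'I_n -> 'I_n -> bounded_op H).
Hypothesis hQ : q_commuting_on T Q setT.
Implicit Types (x y z u v : H) (L M N F : set H) (A : 'I_n -> Prop).

Lemma Q_adjoint i j x y : i != j -> hdot (Q i j x) y = hdot x (Q j i y).
Proof.
move=> ij; have ji : j != i by rewrite eq_sym.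
by case: hQ => _ /(_ _ _ ji)[_ adjQ] _ _ _; exact: adjQ.
Qed.

(** [Q j i] is the adjoint of the unitary [Q i j], hence its inverse. *)
Lemma Q_inverse i j x : i != j -> Q i j (Q j i x) = x.
Proof.
move=> ij; case: hQ => _ /(_ _ _ ij)[[_ [S [_ QS _ QSK]]] _] _ _ _.
suff -> : Q j i x = S x by exact: QSK.
by apply: hdot_inj => z; rewrite -QS// Q_adjoint.
Qed.

Lemma TQ_commute i j k x : i != j -> T k (Q i j x) = Q i j (T k x).
Proof. by case: hQ => _ _ _ _ TQ ij; exact: TQ. Qed.

Lemma adjTQ_commute i j k x :
  i != j -> adj (T k) (Q i j x) = Q i j (adj (T k) x).
Proof.
move=> ij; have ji : j != i by rewrite eq_sym.
apply: hdot_inj => z.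
by rewrite -adjE -!(Q_adjoint _ _ ji) -TQ_commute// adjE.
Qed.

Lemma T_commute i j x : i != j -> T i (T j x) = Q i j (T j (T i x)).
Proof. by case: hQ => _ _ _ TT _ ij; exact: TT. Qed.

(** This is the adjoint of the relation for [T j] and [T i]; the indices of [Q] are swapped twice,
    once by reversing the product and once by the adjoint. *)
Lemma adjT_commute i j x :
  i != j -> adj (T i) (adj (T j) x) = Q i j (adj (T j) (adj (T i) x)).
Proof.
move=> ij; have ji : j != i by rewrite eq_sym.
apply: hdot_inj => z; rewrite -!adjE -(Q_adjoint _ _ ji) -!adjE.
by rewrite (T_commute _ ji) !TQ_commute.
Qed.

Inductive letter : (H -> H) -> Prop :=
| letter_T i : letter (T i)
| letter_adj i : letter (adj (T i))
| letter_Q i j : i != j -> letter (Q i j).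

Lemma letter_adjoint f : letter f ->
  exists2 g, letter g & forall x y, hdot (f x) y = hdot x (g y).
Proof.
case=> [i|i|i j ij].
- by exists (adj (T i)) => [|x y]; [exact: letter_adj | exact: adjE].
- by exists (T i) => [|x y]; [exact: letter_T | exact: adjEC].
- exists (Q j i) => [|x y]; last exact: Q_adjoint.
  by apply: letter_Q; rewrite eq_sym.
Qed.

Definition stable M := forall f, letter f -> forall x, M x -> M (f x).

Lemma stable_orthocomplement L M :
  stable L -> stable M -> stable (orthocomplement L M).
Proof.
move=> stL stM f lf x [Lx xM]; split; first exact: stL.
by move=> y My; have [g lg ->] := letter_adjoint lf; apply: xM; exact: stM.
Qed.

Lemma joint_reducing_onP L M : closed_subspace L -> stable L ->
  joint_reducing_on T Q L M <-> [/\ closed_subspace M, M `<=` L & stable M].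
Proof.
move=> clL stL; split=> [[clM ML redT redQ]|[clM ML stM]].
  split=> // _ [i|i|i j ij] x Mx.
  - by have [_ _ + _] := redT i; exact.
  - by apply: reduces_on_adj (redT i) x Mx => // y; apply/stL/letter_adj.
  - by have [_ _ + _] := redQ i j ij; exact.
split=> // [i|i j ij].
  apply: (@reduces_on_adjoint _ _ _ _ _ (adj (T i))) => //.
  - by move=> x y; exact: adjE.
  - by move=> x; apply/stL/letter_T.
  - by move=> x; apply/stM/letter_T.
  - by move=> x; apply/stM/letter_adj.
have ji : j != i by rewrite eq_sym.
apply: (@reduces_on_adjoint _ _ _ _ _ (Q j i)) => //.
- by move=> x y; exact: Q_adjoint.
- by move=> x; apply/stL/letter_Q.
- by move=> x; apply/stM/letter_Q.
- by move=> x; apply/stM/letter_Q.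
Qed.

Lemma stable_unitary_onP M k : closed_subspace M -> stable M ->
  unitary_on M (T k) <-> forall x, M x -> unitary_at (T k) x.
Proof.
move=> clM stM; apply: unitary_onP => //.
  by move=> x; apply/stM/letter_T.
by move=> x; apply/stM/letter_adj.
Qed.

(** * Largest parts on which given operators are unitary *)

Inductive defect A : set H :=
| defect_l k z : A k -> defect A (adj (T k) (T k z) - z)
| defect_r k z : A k -> defect A (T k (adj (T k) z) - z)
| defect_letter f v : letter f -> defect A v -> defect A (f v).

(** A set and its closed linear span have the same annihilator, so [defect] collects words only,
    without linear combinations. *)
Definition unitary_part A : set H := annihilator (defect A).

Lemma closed_unitary_part A : closed_subspace (unitary_part A).
Proof. exact: closed_subspace_annihilator. Qed.

Lemma stable_unitary_part A : stable (unitary_part A).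
Proof.
move=> f lf x Ux v Av; have [g lg ->] := letter_adjoint lf.
exact/Ux/defect_letter.
Qed.

Lemma unitary_part_at A k x : A k -> unitary_part A x -> unitary_at (T k) x.
Proof.
move=> Ak Ux; split; apply: hdot_inj => z; apply: subr0_eq.
  by rewrite -adjE -adjEC -hdotBl; apply/hdot_eq0C/Ux/defect_l.
by rewrite -adjEC -adjE -hdotBl; apply/hdot_eq0C/Ux/defect_r.
Qed.

(** By induction on the defect vector: its outer letter moves to the other side of the form as an
    adjoint letter, under which [N] is stable. Allowing any stable set [N] makes this applicable to
    orbits. *)
Lemma unitary_part_max A N : stable N ->
  (forall k, A k -> forall x, N x -> unitary_at (T k) x) ->
  N `<=` unitary_part A.
Proof.
move=> stN uN x Nx v Av; elim: Av x Nx => [k z Ak|k z Ak|f w lf _ IH] x Nx.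
- by have [Tx _] := uN k Ak x Nx; rewrite hdotBr -adjE -adjEC Tx subrr.
- by have [_ Tx] := uN k Ak x Nx; rewrite hdotBr -adjEC -adjE Tx subrr.
- have [g lg fg] := letter_adjoint lf.
  by apply: hdot_eq0C; rewrite fg; apply/hdot_eq0C/IH/stN.
Qed.

(* The projection onto a stable subspace commutes with every letter, so it
   maps [unitary_part A] into itself. *)
Lemma unitary_part_projection A F y p : closed_subspace F -> stable F ->
  unitary_part A y -> F p -> (forall z, F z -> hdot (y - p) z = 0) ->
  unitary_part A p.
Proof.
move=> clF stF Uy Fp yp.
(* The set of all projections onto [F] of vectors of [unitary_part A]. *)
pose N := [set p | F p /\ exists2 y, unitary_part A y &
                     forall z, F z -> hdot (y - p) z = 0].
apply: (@unitary_part_max A N)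
  => [f lf q [Fq [w Uw wq]]|k Ak q [Fq [w Uw wq]]|].
- split; first exact: stF.
  exists (f w) => [|z Fz]; first exact: stable_unitary_part.
  have [g lg fg] := letter_adjoint lf.
  by rewrite hdotBl !fg -hdotBl wq//; exact: stF.
- have [Tw wT] := unitary_part_at Ak Uw.
  have fix_q f g : letter f -> letter g -> f (g w) = w ->
      (forall x y, hdot (f x) y = hdot x (g y)) ->
      (forall x y, hdot (g x) y = hdot x (f y)) -> f (g q) = q.
    move=> lf lg fgw fg gf; apply: subr0_eq; apply: hdot_self_eq0.
    set e := f (g q) - q.
    have Fe : F e by apply: closed_subspaceB => //; exact/stF/stF.
    (* Both [f (g w) - f (g q)] and [w - q] are orthogonal to [F]; their difference is [- e] with
       [e] in [F], so [e] vanishes. *)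
    have : hdot (f (g w) - f (g q) - (w - q)) e = 0.
      rewrite hdotBl hdotBl !fg !gf -hdotBl wq ?sub0r; last exact/stF/stF.
      by rewrite wq// oppr0.
    have -> : f (g w) - f (g q) - (w - q) = - e.
      by rewrite fgw /e !opprB addrC addrA subrK.
    by rewrite hdotNl => /eqP; rewrite oppr_eq0 => /eqP.
  split; apply: fix_q => //; try solve [exact: letter_T | exact: letter_adj
    | exact: adjE | exact: adjEC].
- by split=> //; exists y.
Qed.

(** * Orbits under the letters other than [T i] and its adjoint *)

Definition all_unitary_part := unitary_part (fun=> True).
Definition nearly_unitary_part i := unitary_part (fun k => k != i).
Definition cnu_part i :=
  orthocomplement (nearly_unitary_part i) all_unitary_part.

Inductive other_letter i : (H -> H) -> Prop :=
| other_T j : j != i -> other_letter i (T j)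
| other_adj j : j != i -> other_letter i (adj (T j))
| other_Q j k : j != k -> other_letter i (Q j k).

Lemma other_letterW i f : other_letter i f -> letter f.
Proof.
case=> [j _|j _|j k jk]; first exact: letter_T.
  exact: letter_adj.
exact: letter_Q.
Qed.

(** An orbit rather than a linear span: words in the other letters applied to vectors of [N]. *)
Inductive span_other i N : set H :=
| span_other_id x : N x -> span_other i N x
| span_other_letter f x :
    other_letter i f -> span_other i N x -> span_other i N (f x).

(* Where the other [T j] are unitary, [T j] and [(T j)^*] intertwine both [T i]
   and [(T i)^*] up to unitaries [Q i j] and [Q j i]. *)
Lemma other_letter_twist i f : other_letter i f ->
  exists q q' : H -> H,
    [/\ (q = id /\ q' = id) \/
         (exists2 j, j != i & (q = Q i j /\ q' = Q j i) \/
                              (q = Q j i /\ q' = Q i j)),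
      forall x, nearly_unitary_part i x -> T i (f x) = q (f (T i x))
    & forall x, nearly_unitary_part i x ->
       adj (T i) (f x) = q' (f (adj (T i) x))].
Proof.
case=> [j ji|j ji|j k jk].
- have ij : i != j by rewrite eq_sym.
  exists (Q i j), (Q j i); split=> [|x Ux|x Ux].
  + by right; exists j => //; left.
  + exact: T_commute.
  + have st := @stable_unitary_part (fun k => k != i).
    have [Tx _] := unitary_part_at ji Ux.
    (* The relation between (T i)^* and [T j] follows from that between the two adjoints: (T j)^*
       sends [y] to (T i)^* x, and applying the unitary [T j] recovers [y]. *)
    pose y := adj (T i) (Q i j (T j x)).
    have Uy : nearly_unitary_part i y.
      by apply/st/st/st => //;
        [exact: letter_adj | exact: letter_Q | exact: letter_T].
    have [_ yE] := unitary_part_at ji Uy.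
    have : adj (T j) y = adj (T i) x.
      by rewrite /y adjT_commute// -!adjTQ_commute// Q_inverse// Tx.
    move=> yx; rewrite -yx yE /y adjTQ_commute// Q_inverse//.
- have ij : i != j by rewrite eq_sym.
  exists (Q j i), (Q i j); split=> [|x Ux|x Ux].
  + by right; exists j => //; right.
  + have st := @stable_unitary_part (fun k => k != i).
    have [_ xT] := unitary_part_at ji Ux.
    have Uy : nearly_unitary_part i (T i (adj (T j) x)).
      by apply/st/st => //; [exact: letter_T | exact: letter_adj].
    have [yE _] := unitary_part_at ji Uy.
    rewrite -{2}xT (T_commute _ ij) adjTQ_commute// yE Q_inverse//.
  + exact: adjT_commute.
- exists id, id; split=> [|x _|x _]; first by left.
  + exact: TQ_commute.
  + exact: adjTQ_commute.
Qed.

(** The orbit of [N] under the other letters is stable under all letters and every [T k] is unitary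
    on it, so [unitary_part_max] applies to the orbit. *)
Lemma unitary_reducing_sub_all i N :
  N `<=` nearly_unitary_part i ->
  invariant_on N (T i) -> invariant_on N (adj (T i)) ->
  (forall x, N x -> unitary_at (T i) x) ->
  N `<=` all_unitary_part.
Proof.
move=> NU NT Nadj uN.
have SU : span_other i N `<=` nearly_unitary_part i.
  move=> x; elim=> [y /NU//|f y /other_letterW lf _ Uy].
  exact: stable_unitary_part.
have Sq q q' : (q = id /\ q' = id) \/
         (exists2 j, j != i & (q = Q i j /\ q' = Q j i) \/
                              (q = Q j i /\ q' = Q i j)) ->
   [/\ forall x, span_other i N x -> span_other i N (q x),
       forall x, span_other i N x -> span_other i N (q' x),
       cancel q q' /\ cancel q' q,
       forall x, adj (T i) (q x) = q (adj (T i) x)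
     & forall x, T i (q' x) = q' (T i x)].
  case=> [[-> ->]|[j ji qq]]; first by split.
  have ij : i != j by rewrite eq_sym.
  case: qq => -[-> ->]; split=> [x Sx|x Sx||x|x];
    try solve [by apply: span_other_letter Sx; exact: other_Q
    | by split=> x; exact: Q_inverse | exact: adjTQ_commute
    | exact: TQ_commute].
have ST x : span_other i N x -> span_other i N (T i x).
  elim=> [y /NT|f y lf Sy STy]; first exact: span_other_id.
  have [q [q' [/Sq[qS _ _ _ _] Tf _]]] := other_letter_twist lf.
  rewrite (Tf y (SU y Sy)).
  exact/qS/span_other_letter.
have Sadj x : span_other i N x -> span_other i N (adj (T i) x).
  elim=> [y /Nadj|f y lf Sy STy]; first exact: span_other_id.
  have [q [q' [/Sq[_ qS _ _ _] _ adjf]]] := other_letter_twist lf.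
  rewrite (adjf y (SU y Sy)).
  exact/qS/span_other_letter.
(* Passing [T i] and then its adjoint through a letter [f] produces the twists [q] and [q'], which
   cancel. *)
have Si x : span_other i N x -> unitary_at (T i) x.
  elim=> [y /uN//|f y lf Sy [Ty yT]].
  have [q [q' [/Sq[_ _ [qK q'K] adjq Tq'] Tf adjf]]] := other_letter_twist lf.
  split.
    by rewrite Tf ?adjq ?adjf ?Ty ?q'K//; apply: SU => //; exact: ST.
  by rewrite adjf ?Tq' ?Tf ?yT ?qK//; apply: SU => //; exact: Sadj.
move=> x Nx.
apply: (@unitary_part_max _ (span_other i N)); last exact: span_other_id.
  move=> _ [j|j|j k jk] y Sy.
  - have [->|ji] := eqVneq j i; first exact: ST.
    by apply: span_other_letter => //; exact: other_T.
  - have [->|ji] := eqVneq j i; first exact: Sadj.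
    by apply: span_other_letter => //; exact: other_adj.
  - by apply: span_other_letter => //; exact: other_Q.
move=> k _ y Sy; have [->|ki] := eqVneq k i; first exact: Si.
exact: (unitary_part_at ki (SU y Sy)).
Qed.

(** * The summands and their orthogonality *)

Lemma stable_cnu_part i : stable (cnu_part i).
Proof. by apply: stable_orthocomplement; exact: stable_unitary_part. Qed.

Lemma closed_cnu_part i : closed_subspace (cnu_part i).
Proof. exact/closed_subspace_orthocomplement/closed_unitary_part. Qed.

(** Project [x] onto [nearly_unitary_part k]. The projection [p] stays in [nearly_unitary_part i],
    so every [T j] is unitary at [p]; hence [p] lies in [all_unitary_part], to which [y] is
    orthogonal. *)
Lemma cnu_part_ortho i k : i != k -> orthogonal_sets (cnu_part i) (cnu_part k).
Proof.
move=> ik x y [Ux _] [Uy yall].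
have [p [Up xp]] := projection_exists x (closed_unitary_part (fun j => j != k)).
have st := @stable_unitary_part (fun j => j != k).
have Uip := unitary_part_projection (closed_unitary_part _) st Ux Up xp.
have allp : all_unitary_part p.
  pose N := nearly_unitary_part i `&` nearly_unitary_part k.
  apply: (@unitary_part_max _ N) => //.
    by move=> f lf z [iz kz]; split; exact: stable_unitary_part.
  move=> j _ z [iz kz]; have [ji|ji] := eqVneq j i.
    by rewrite ji; apply: (unitary_part_at _ kz).
  exact: (unitary_part_at ji iz).
rewrite -[x](subrK p) hdotDl xp// add0r.
exact/hdot_eq0C/yall.
Qed.

(** Index [ord0] stands for the type with all entries unitary, [lift ord0 i] for the type whose only
    c.n.u. entry is the one at [i]. *)
Definition component (t : 'I_n.+1) : set H :=
  if unlift ord0 t is Some i then cnu_part i else all_unitary_part.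

Lemma component0 : component ord0 = all_unitary_part.
Proof. by rewrite /component unlift_none. Qed.

Lemma component_lift i : component (lift ord0 i) = cnu_part i.
Proof. by rewrite /component liftK. Qed.

Lemma closed_component t : closed_subspace (component t).
Proof.
rewrite /component; case: unliftP => [i _|_]; first exact: closed_cnu_part.
exact: closed_unitary_part.
Qed.

Lemma stable_component t : stable (component t).
Proof.
rewrite /component; case: unliftP => [i _|_]; first exact: stable_cnu_part.
exact: stable_unitary_part.
Qed.

Lemma component_ortho s t :
  s != t -> orthogonal_sets (component s) (component t).
Proof.
rewrite /component; case: unliftP => [i ->|->]; case: unliftP => [k ->|->].
- by rewrite (inj_eq lift_inj); exact: cnu_part_ortho.
- by move=> _ x y [_ xall] /xall.
- by move=> _ x y ax [_ yall]; exact/hdot_eq0C/yall.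
- by rewrite eqxx.
Qed.

Definition residual_part : set H := annihilator (\bigcup_t component t).

Lemma closed_residual_part : closed_subspace residual_part.
Proof. exact: closed_subspace_annihilator. Qed.

Lemma stable_residual_part : stable residual_part.
Proof.
move=> f lf x rx v [t _ tv]; have [g lg ->] := letter_adjoint lf.
by apply: rx; exists t => //; exact: stable_component.
Qed.

Lemma sub_nearly_unitary_part i M : closed_subspace M -> stable M ->
  (forall k, k != i -> unitary_on M (T k)) -> M `<=` nearly_unitary_part i.
Proof.
move=> clM stM uM; apply: unitary_part_max => // k /uM.
by move/stable_unitary_onP; exact.
Qed.

Lemma sub_all_unitary_part M : closed_subspace M -> stable M ->
  (forall k, unitary_on M (T k)) -> M `<=` all_unitary_part.
Proof.
move=> clM stM uM; apply: unitary_part_max => // k _.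
by have /stable_unitary_onP := uM k; exact.
Qed.

(** * Types and maximality of the summands *)

Hypothesis hT : forall i, contraction_on setT (T i).

Lemma stable_contraction M k : stable M -> contraction_on M (T k).
Proof.
move=> stM; split=> [x|x _]; first exact/stM/letter_T.
by have [_ ->] := hT k.
Qed.

Lemma cnu_part_unitary i k : k != i -> unitary_on (cnu_part i) (T k).
Proof.
move=> ki; apply/stable_unitary_onP; first exact: closed_cnu_part.
  exact: stable_cnu_part.
by move=> x [Ux _]; exact: (unitary_part_at ki Ux).
Qed.

(** A subspace reducing [T i] to a unitary lies in [all_unitary_part] by [unitary_reducing_sub_all],
    and is orthogonal to it as part of [cnu_part i]. *)
Lemma cnu_part_cnu i : cnu_on (cnu_part i) (T i).
Proof.
split; first exact/stable_contraction/stable_cnu_part.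
move=> M redM uM; have [clM ML MT _] := redM.
have Madj : invariant_on M (adj (T i)).
  apply: reduces_on_adj redM; first exact: closed_cnu_part.
  by move=> x; apply/stable_cnu_part/letter_adj.
have Mall : M `<=` all_unitary_part.
  apply: (@unitary_reducing_sub_all i) => //; first by move=> x /ML[].
  exact/unitary_onP.
apply: closed_subspace_eq0 => // x Mx; apply: hdot_self_eq0.
by have [_ xall] := ML x Mx; exact/xall/Mall.
Qed.

(** A vector [y] of [all_unitary_part] projects into [K], which reduces [T i] to a unitary. As [T i]
    is c.n.u. on [M], [K] is zero, so [y] is orthogonal to [M]. *)
Lemma sub_cnu_part i M : closed_subspace M -> stable M ->
  (forall k, k != i -> unitary_on M (T k)) -> cnu_on M (T i) ->
  M `<=` cnu_part i.
Proof.
move=> clM stM uM [_ cM] x Mx; split; first exact: sub_nearly_unitary_part Mx.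
move=> y ay; have [p [Mp yp]] := projection_exists y clM.
have ap := unitary_part_projection clM stM ay Mp yp.
pose K := M `&` all_unitary_part.
have clK : closed_subspace K.
  have [A0 AD clA] := closed_unitary_part (fun=> True).
  have [M0 MD clM'] := clM.
  split; [by split| |exact: closedI].
  by move=> a u v [Mu Au] [Mv Av]; split; [exact: MD|exact: AD].
have stK : stable K.
  by move=> f lf z [Mz Az]; split; [exact: stM | exact: stable_unitary_part].
have K0 : K = [set 0].
  apply: cM; last first.
    by apply/stable_unitary_onP => // z [_ Az]; exact: (unitary_part_at _ Az).
  have [] // : joint_reducing_on T Q M K.
  by apply/joint_reducing_onP => //; split=> // z [].
have p0 : p = 0 by have : K p by []; rewrite K0.
by move: (yp x Mx); rewrite p0 subr0; exact: hdot_eq0C.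
Qed.

Lemma joint_reducing_setP M :
  joint_reducing_on T Q setT M <-> closed_subspace M /\ stable M.
Proof.
have clT : closed_subspace [set: H] by split=> //; exact: closedT.
rewrite joint_reducing_onP//; first by split=> [[]|[]].
Qed.

(** If at most one entry on [M] fails to be unitary, then [M] lies in one of the components; being
    orthogonal to all of them, it is orthogonal to itself. *)
Lemma residual_strongly_cnu : strongly_cnu_on T Q residual_part.
Proof.
move=> M /(joint_reducing_onP _ closed_residual_part stable_residual_part).
move=> [clM Mres stM] /all_but_at_most_oneP uM.
apply: closed_subspace_eq0 => // x Mx; apply: hdot_self_eq0.
apply: (Mres x Mx).
case: uM => [uM|[i [_ uM]]].
  exists ord0 => //; rewrite component0; exact: (sub_all_unitary_part clM stM).
exists (lift ord0 i) => //; rewrite component_lift; split.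
  exact: (sub_nearly_unitary_part clM stM).
(* Orthogonality to [all_unitary_part] comes from the residual part, so no c.n.u. assumption on
   [T i] enters. *)
by move=> y ay; apply: (Mres x Mx); exists ord0; rewrite ?component0.
Qed.

Lemma residual_q_commuting : q_commuting_on T Q residual_part.
Proof.
have st := stable_residual_part.
case: hQ => _ _ QQ TT TQ.
split=> [k x|i j ij|i j k l ij kl x _|i j ij x _|i j k ij x _].
- exact/st/letter_T.
- have ji : j != i by rewrite eq_sym.
  split; last by move=> x y _ _; exact: Q_adjoint.
  split; first by move=> x; exact/st/letter_Q.
  exists (Q j i); split=> [x|x y _ _|x _|x _].
  + exact/st/letter_Q.
  + exact: Q_adjoint.
  + exact: Q_inverse.
  + exact: Q_inverse.
- exact: (QQ _ _ _ _ ij kl x I).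
- exact: (TT _ _ ij x I).
- exact: (TQ _ _ _ ij x I).
Qed.

Lemma component_type i t :
  unitary_on (component t) (T i) \/ cnu_on (component t) (T i).
Proof.
rewrite /component; case: unliftP => [k _|_]; last first.
  left; apply/stable_unitary_onP; [exact: closed_unitary_part
    | exact: stable_unitary_part|].
  by move=> x ax; exact: (unitary_part_at _ ax).
have [->|ik] := eqVneq i k; first by right; exact: cnu_part_cnu.
by left; exact: cnu_part_unitary.
Qed.

Lemma component_largest (theta : 'I_n -> op_type) :
  all_but_at_most_one (fun k => theta k = A_u) ->
  exists t, largest (joint_reducing_of_type T Q theta) (component t).
Proof.
case/all_but_at_most_oneP => [u|[i [ci ui]]].
  exists ord0; rewrite component0; split.
    split; first by apply/joint_reducing_setP; split;
      [exact: closed_unitary_part | exact: stable_unitary_part].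
    move=> k; rewrite u /=; apply/stable_unitary_onP;
      [exact: closed_unitary_part | exact: stable_unitary_part|].
    by move=> x ax; exact: (unitary_part_at _ ax).
  move=> M [/joint_reducing_setP[clM stM] typM].
  by apply: sub_all_unitary_part => // k; have := typM k; rewrite u.
have {}ci : theta i = A_cnu by case: (theta i) ci.
exists (lift ord0 i); rewrite component_lift; split.
  split; first by apply/joint_reducing_setP; split;
    [exact: closed_cnu_part | exact: stable_cnu_part].
  move=> k; have [->|ki] := eqVneq k i.
    by rewrite ci; exact: cnu_part_cnu.
  by rewrite ui//; exact: cnu_part_unitary.
move=> M [/joint_reducing_setP[clM stM] typM]; apply: sub_cnu_part => //.
  by move=> k ki; have := typM k; rewrite ui.
by have := typM i; rewrite ci.
Qed.

End QCommutingTuple.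

Theorem theorem5p6 (R : realType) (H : hilbertType R) (n : nat)
    (T : 'I_n -> bounded_op H) (Q : 'I_n -> 'I_n -> bounded_op H)
    (hQ : q_commuting_on T Q setT)
    (hT : forall i, contraction_on setT (T i)) :
  exists (Hs : set H) (Hj : 'I_n.+1 -> set H),
    [/\ orthogonal_decomposition Hs Hj,
        (joint_reducing_on T Q setT Hs /\
          forall j, joint_reducing_on T Q setT (Hj j)),
        (forall i j, unitary_on (Hj j) (T i) \/ cnu_on (Hj j) (T i)),
        (forall theta : 'I_n -> op_type,
          all_but_at_most_one (fun k => theta k = A_u) ->
          exists! Ht : set H, (exists t, Ht = Hj t) /\
            largest (joint_reducing_of_type T Q theta) Ht)
      & [/\ q_commuting_on T Q Hs,
            (forall i, contraction_on Hs (T i))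
          & strongly_cnu_on T Q Hs]].
Proof.
exists (residual_part T Q), (component T Q); split.
- apply: orthogonal_decomposition_annihilator.
    by move=> t; exact: closed_component.
  by move=> s t; exact: component_ortho.
- split=> [|t]; apply/joint_reducing_setP => //; split.
  + exact: closed_residual_part.
  + exact: stable_residual_part.
  + exact: closed_component.
  + exact: stable_component.
- by move=> i t; exact: component_type.
- move=> theta /(component_largest hQ hT)[t [typ_t max_t]].
  exists (component T Q t); split; first by split; first exists t.
  (* Uniqueness concerns the subspace and not its index, since several components may be zero: two
     largest subspaces contain each other. *)
  move=> M [_ [typM maxM]]; apply/seteqP; split; first exact: maxM.
  exact: max_t.
- split; first exact: residual_q_commuting.
    by move=> i; apply: stable_contraction => //; exact: stable_residual_part.
  exact: residual_strongly_cnu.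
Qed.
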